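(* Let $\Delta\ge0$. $R_{\rm cut}^{(\lambda)}(\Delta|P)$ is a monotone decreasing function of $\lambda$ (for $0<\lambda\le1$; decreasing in the sense of non-increasing). Moreover, if $0<\lambda\le\frac{1}{8\alpha}$, then $$0\le R(\Delta|P)-R_{\rm cut}^{(\lambda)}(\Delta|P)\le c_1\sqrt{\lambda}\,\big(\log\lambda^{-1}+c_2\big),$$ where $c_1=\frac32\sqrt{2\alpha}$, $c_2=\frac43\log(|\mathcal{X}||\mathcal{Y}|)-\log(2\alpha)+\frac23 d_{\max}|R'(\Delta|P)|$, and $R'(\Delta|P)=\frac{\mathrm d}{\mathrm d\Delta}R(\Delta|P)$. This inequality implies that $$\lim_{\lambda\to0+}R_{\rm cut}^{(\lambda)}(\Delta|P)=R(\Delta|P).$$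
   Context: $\mathcal{X},\mathcal{Y}$ are finite sets, $P$ is a probability distribution on $\mathcal{X}$, and $d:\mathcal{X}\times\mathcal{Y}\to[0,\infty)$ is a distortion measure such that for every $x\in\mathcal{X}$ there is $y\in\mathcal{Y}$ with $d(x,y)=0$. Put $\alpha=\min\{\log|\mathcal{X}|,\log|\mathcal{Y}|\}$ and $d_{\max}=\max_{(x,y)\in\mathcal{X}\times\mathcal{Y}}d(x,y)$. Logarithms are natural. For a joint distribution $q=q_{XY}$ on $\mathcal{X}\times\mathcal{Y}$, $q_X$ is its $X$-marginal, $q_{Y|X}$ its conditional distribution of $Y$ given $X$, $I(q_X,q_{Y|X})$ the mutual information of $(X,Y)\sim q$, $\mathrm{E}_q$ expectation under $q$, and $D(\cdot\|\cdot)$ is Kullback–Leibler divergence. The rate distortion function is $$R(\Delta|P)=\min_{V:\ \mathrm{E}_{(P,V)}[d(X,Y)]\le\Delta}I(P,V),$$ the minimum being over conditional distributions $V$ on $\mathcal{Y}$ given $\mathcal{X}$, with $(P,V)$ the joint distribution $P(x)V(y|x)$. The cutoff rate is, for $\lambda>0$, $$R_{\rm cut}^{(\lambda)}(\Delta|P)=\min_{q_{XY}\in\mathcal{P}(\mathcal{X}\times\mathcal{Y}):\ \mathrm{E}_q[d(X,Y)]\le\Delta}\Big\{I(q_X,q_{Y|X})+\frac1\lambda D(q_X\|P)\Big\},$$ where $\mathcal{P}(\mathcal{X}\times\mathcal{Y})$ is the set of probability distributions on $\mathcal{X}\times\mathcal{Y}$. *)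

(* Defs.v *)
(* MathComp-Analysis: [R : realType], [ln] is the natural logarithm. *)
From mathcomp Require Import all_boot all_order all_algebra.
From mathcomp Require Import all_classical all_reals all_analysis.
Set Implicit Arguments.
Unset Strict Implicit.
Unset Printing Implicit Defensive.
Import Order.TTheory GRing.Theory Num.Theory numFieldNormedType.Exports.
Local Open Scope classical_set_scope.
Local Open Scope ring_scope.

Section Distributions.
Context {R : realType}.

Definition is_dist (T : finType) (p : T -> R) : Prop :=
  (forall t, 0 <= p t) /\ \sum_t p t = 1.

(* The convention 0 log (0 / r) = 0 is automatic; the value is +oo when [p] is
   not absolutely continuous with respect to [r]. *)
Definition KL (T : finType) (p r : T -> R) : \bar R :=
  if [forall t, (r t == 0) ==> (p t == 0)]
  then (\sum_t p t * ln (p t / r t))%:E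
  else +oo%E.

Variables X Y : finType.

Definition is_channel (V : X -> Y -> R) : Prop := forall x, is_dist (V x).

Definition joint (P : X -> R) (V : X -> Y -> R) : X * Y -> R :=
  fun z => P z.1 * V z.1 z.2.

Definition marginalX (q : X * Y -> R) : X -> R := fun x => \sum_y q (x, y).

Definition marginalY (q : X * Y -> R) : Y -> R := fun y => \sum_x q (x, y).

(* Mutual information of (X, Y) ~ q.  Whenever [q z != 0] both marginals are
   positive at [z], so only the convention 0 log(_) = 0 is involved. *)
Definition mutual_info (q : X * Y -> R) : R :=
  \sum_z q z * ln (q z / (marginalX q z.1 * marginalY q z.2)).

Definition expected_distortion (d : X -> Y -> R) (q : X * Y -> R) : R :=
  \sum_z q z * d z.1 z.2.

(* The two minima below are written as infima; for a distortion measure with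
   zero-distortion letters and [0 <= Delta] the feasible sets are nonempty and
   compact and the infima are attained. *)
Definition rate_distortion (P : X -> R) (d : X -> Y -> R) (Delta : R) : R :=
  inf [set mutual_info (joint P V) | V in
        [set V : X -> Y -> R |
          is_channel V /\ expected_distortion d (joint P V) <= Delta]].

(* Extended-real valued because the divergence may be +oo. *)
Definition cutoff_rate (P : X -> R) (d : X -> Y -> R) (Delta lambda : R)
    : \bar R :=
  ereal_inf [set ((mutual_info q)%:E + (1 / lambda)%:E * KL (marginalX q) P)%E
            | q in [set q : X * Y -> R |
                     is_dist q /\ expected_distortion d q <= Delta]].

(* [dmax] is the maximum of [d] for [0 <= d] and [X], [Y] nonempty. *)
Definition dmax (d : X -> Y -> R) : R :=
  \big[Num.max/0]_(z : X * Y) d z.1 z.2.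

End Distributions.

(* [l] is the derivative at [x] of [f] regarded as a function on the domain [D]:
   the two-sided derivative when [x] is interior to [D], the one-sided one at an
   endpoint of an interval. *)
Definition has_derivative_on {R : realType} (D : set R) (f : R -> R) (x l : R)
    : Prop :=
  h^-1 * (f (x + h) - f x) @[h --> within [set h | D (x + h)] 0^'] --> l.

(* Main.v *)
(* If [q] does better than [R(Delta|P)] for the cutoff rate, then
   [D(q_X||P) <= lambda alpha], so [P] and [q_X] are within total variation
   [theta = sqrt (2 alpha lambda)].  Using the channel of [q] with input [P] moves
   the distortion by at most [dmax theta], paid for through the convexity of
   [R(.|P)], and the mutual information by at most
   [theta ln (1 / theta) + theta + 2 theta ln |Y|].  The right derivative of
   [R(.|P)] may be infinite at [Delta = 0], so the limit rests instead on the right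
   continuity of [R(.|P)], which at [0] uses that the positive distortions are
   bounded below. *)
Require Import Defs.
From mathcomp Require Import all_boot all_order all_algebra.
From mathcomp Require Import all_classical all_reals all_analysis.
From mathcomp Require Import ring lra.
Set Implicit Arguments.
Unset Strict Implicit.
Unset Printing Implicit Defensive.
Import Order.TTheory GRing.Theory Num.Theory numFieldNormedType.Exports.
Local Open Scope classical_set_scope.
Local Open Scope ring_scope.

(** * The function [- t ln t] and its elementary bounds *)

Section EntropyFunction.
Context {R : realType}.
Implicit Types a b c s t : R.

Definition eta t : R := - (t * ln t).

Lemma ln_le_sub1 t : 0 < t -> ln t <= t - 1.
Proof.
move=> t0; have := @le_ln1Dx R (t - 1).
by rewrite (_ : 1 + (t - 1) = t); [apply; lra | lra].
Qed.

(* The supporting line of the convex function [a ln (a / b)] along [a / b = c]; the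
   log-sum, Jensen and Gibbs inequalities below are all sums of instances. *)
Lemma xlnx_tangent a b c : 0 <= a -> 0 <= b -> (b = 0 -> a = 0) -> 0 < c ->
  a * ln c + a - b * c <= a * ln (a / b).
Proof.
move=> a0 b0 ba c0.
have [->|an0] := eqVneq a 0; first by rewrite !mul0r; nra.
have a_gt0 : 0 < a by rewrite lt_neqAle eq_sym an0.
have b_gt0 : 0 < b.
  by rewrite lt_neqAle b0 andbT eq_sym; apply: contra_neq an0 => /ba.
have abc0 : 0 < b * c / a by rewrite divr_gt0 ?mulr_gt0.
have H := ln_le_sub1 abc0.
have E : ln (b * c / a) = ln c - ln (a / b).
  rewrite !ln_div ?posrE ?mulr_gt0// lnM ?posrE//; ring.
rewrite E in H.
have : a * (ln c - ln (a / b)) <= a * (b * c / a - 1) by rewrite ler_wpM2l.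
rewrite mulrBr mulrBr mulr1 (_ : a * (b * c / a) = b * c); last by field.
lra.
Qed.

Lemma eta0 : eta 0 = 0. Proof. by rewrite /eta mul0r oppr0. Qed.

Lemma eta1 : eta 1 = 0. Proof. by rewrite /eta ln1 mulr0 oppr0. Qed.

Lemma eta_ge0 t : 0 <= t -> t <= 1 -> 0 <= eta t.
Proof. by move=> t0 t1; rewrite /eta -mulrN mulr_ge0// oppr_ge0 ln_le0. Qed.

Lemma eta_tangent a c : 0 <= a -> 0 < c -> eta a <= - (a * ln c) - a + c.
Proof.
move=> a0 c0; have ac : (1 : R) = 0 -> a = 0 by move/eqP; rewrite oner_eq0.
by have := xlnx_tangent a0 ler01 ac c0; rewrite invr1 mulr1 mul1r /eta; lra.
Qed.

(** Both [ln s] and [ln t] are at most [ln (s + t)]; weight them by [s] and [t]. *)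
Lemma le_eta_add s t : 0 <= s -> 0 <= t -> eta (s + t) <= eta s + eta t.
Proof.
move=> s0 t0; have [->|sn0] := eqVneq s 0; first by rewrite add0r eta0 add0r.
have [->|tn0] := eqVneq t 0; first by rewrite addr0 eta0 addr0.
have sp : 0 < s by rewrite lt_neqAle eq_sym sn0.
have tp : 0 < t by rewrite lt_neqAle eq_sym tn0.
have H1 : ln s <= ln (s + t) by rewrite ler_ln ?posrE ?addr_gt0//; lra.
have H2 : ln t <= ln (s + t) by rewrite ler_ln ?posrE ?addr_gt0//; lra.
rewrite /eta; nra.
Qed.

(** [eta] alone decreases beyond [1 / e], while [eta t + t] has derivative [- ln t], nonnegative on
    [(0, 1]]. This is what lets a total variation be replaced by an upper bound for it. *)
Lemma eta_addr_le t s : 0 <= t -> t <= s -> s <= 1 -> eta t + t <= eta s + s.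
Proof.
move=> t0 ts s1; have [s0|sn0] := eqVneq s 0.
  by rewrite (_ : t = s)//; lra.
have sp : 0 < s by rewrite lt_neqAle eq_sym sn0 (le_trans t0).
have ln_s : ln s <= 0 by apply: ln_le0.
have : t * - ln s <= s * - ln s by rewrite ler_wpM2r ?oppr_ge0.
have := eta_tangent t0 sp; rewrite [eta s]/eta; lra.
Qed.

(** Apply [ln x <= x - 1] at [x = 1 / sqrt t]. The algebraic bound makes explicit choices of radii
    possible in the continuity arguments. *)
Lemma eta_le_sqrt t : 0 <= t -> eta t <= 2 * Num.sqrt t.
Proof.
rewrite le_eqVlt => /predU1P[<-|t0]; first by rewrite eta0 sqrtr0 mulr0.
set r := Num.sqrt t.
have r0 : 0 < r by rewrite sqrtr_gt0.
have -> : t = r ^+ 2 by rewrite sqr_sqrtr// ltW.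
have := @ln_le_sub1 r^-1; rewrite invr_gt0 => /(_ r0).
rewrite lnV ?posrE// => H.
rewrite /eta expr2 lnM ?posrE// -mulrN.
have -> : - (ln r + ln r) = 2 * - ln r by ring.
have : r * r * - ln r <= r * r * (r^-1 - 1) by rewrite ler_wpM2l// mulr_ge0// ltW.
have -> : r * r * (r^-1 - 1) = r - r * r by field; rewrite gt_eqF.
nra.
Qed.

End EntropyFunction.

(** * Entropy, total variation and divergence on a finite set *)

Section Entropy.
Context {R : realType}.
Implicit Types T : finType.

Definition entropy T (p : T -> R) : R := \sum_t eta (p t).

(* For probability distributions this is the total variation distance. *)
Definition tv T (p r : T -> R) : R := \sum_t Num.max 0 (p t - r t).

(** All tangents are taken at the mean value [S / #|T|]. The total mass is left arbitrary so that
    the bound applies to the positive part of a difference of distributions. *)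
Lemma sum_eta_le T (a : T -> R) : (forall t, 0 <= a t) ->
  \sum_t eta (a t) <= eta (\sum_t a t) + (\sum_t a t) * ln #|T|%:R.
Proof.
move=> a0; set S := \sum_t a t.
have S0 : 0 <= S by apply: sumr_ge0.
have [SE|Sn0] := eqVneq S 0.
  rewrite SE eta0 mul0r addr0 big1// => t _.
  have -> : a t = 0 by exact: (@psumr_eq0P _ _ _ _ (fun i _ => a0 i) SE).
  exact: eta0.
have Sp : 0 < S by rewrite lt_neqAle eq_sym Sn0.
have n0 : (0 : R) < #|T|%:R.
  rewrite ltr0n lt0n; apply: contra_neq Sn0 => /card0_eq T0.
  by rewrite /S big1// => t; move: (T0 t).
have H : forall t, eta (a t) <= - (a t * ln (S / #|T|%:R)) - a t + S / #|T|%:R.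
  by move=> t; apply: eta_tangent => //; rewrite divr_gt0.
apply: (le_trans (ler_sum _ (fun t _ => H t))).
rewrite big_split/= big_split/= !sumrN -mulr_suml -/S.
have -> : \sum_(t : T) S / #|T|%:R = S.
  by rewrite sumr_const -[LHS]mulr_natr divfK// gt_eqF.
by rewrite ln_div ?posrE// /eta; lra.
Qed.

Lemma dist_le1 T (p : T -> R) t : is_dist p -> p t <= 1.
Proof.
move=> [p0 <-]; rewrite (bigD1 t)//= lerDl; exact: sumr_ge0.
Qed.

Lemma dist_card_gt0 T (p : T -> R) : is_dist p -> (0 < #|T|)%N.
Proof.
move=> [_ p1]; rewrite lt0n; apply/eqP => /card0_eq T0.
by move: p1; rewrite big1 => [/eqP|t]; [rewrite eq_sym oner_eq0|move: (T0 t)].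
Qed.

Lemma dist_ln_card_ge0 T (p : T -> R) : is_dist p -> 0 <= ln (#|T|%:R : R).
Proof. by move=> /dist_card_gt0 T0; apply: ln_ge0; rewrite ler1n. Qed.

Lemma entropy_ge0 T (p : T -> R) : is_dist p -> 0 <= entropy p.
Proof.
move=> dp; apply: sumr_ge0 => t _; apply: eta_ge0; last exact: dist_le1.
by case: dp.
Qed.

Lemma entropy_le T (p : T -> R) : is_dist p -> entropy p <= ln #|T|%:R.
Proof.
by move=> [p0 p1]; have := sum_eta_le p0; rewrite p1 eta1 add0r mul1r.
Qed.

Lemma max0_split (x : R) : x = Num.max 0 x - Num.max 0 (- x).
Proof. by rewrite /Num.max; case: ifPn; case: ifPn; lra. Qed.

Lemma tv_ge0 T (p r : T -> R) : 0 <= tv p r.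
Proof. by apply: sumr_ge0 => t _; rewrite le_max lexx. Qed.

(** The differences sum to zero, so their positive and negative parts have equal mass. *)
Lemma tvC T (p r : T -> R) : is_dist p -> is_dist r -> tv p r = tv r p.
Proof.
move=> [_ p1] [_ r1]; apply/eqP; rewrite -subr_eq0 -sumrB; apply/eqP.
transitivity (\sum_t (p t - r t)); last by rewrite sumrB p1 r1 subrr.
by apply: eq_bigr => t _; rewrite [RHS]max0_split opprB.
Qed.

Lemma tv_le1 T (p r : T -> R) : is_dist p -> is_dist r -> tv p r <= 1.
Proof.
move=> [p0 <-] [r0 _]; apply: ler_sum => t _.
by rewrite ge_max p0/=; have := r0 t; lra.
Qed.

Lemma sum_diff_le_tv T (p r f : T -> R) (M : R) :
  (forall t, 0 <= f t) -> (forall t, f t <= M) ->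
  \sum_t p t * f t - \sum_t r t * f t <= tv p r * M.
Proof.
move=> f0 fM; rewrite -sumrB mulr_suml; apply: ler_sum => t _.
rewrite -mulrBl {1}[p t - _]max0_split mulrBl lerBlDr.
apply: le_trans (ler_wpM2l _ (fM t)) _; first by rewrite le_max lexx.
by rewrite lerDl mulr_ge0// le_max lexx.
Qed.

(** Where [p >= r], subadditivity bounds the difference by [eta (p - r)]; where [p < r],
    monotonicity of [eta t + t] bounds it by [r - p]. The first contributions are summed by
    [sum_eta_le], the second add up to [tv r p]. *)
Lemma entropy_sub_le T (p r : T -> R) : is_dist p -> is_dist r ->
  entropy p - entropy r <= eta (tv p r) + tv p r + tv p r * ln #|T|%:R.
Proof.
move=> dp dr.
have pos (x : R) : 0 <= Num.max 0 x by rewrite le_max lexx.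
rewrite addrAC {3}(tvC dp dr).
apply: le_trans (_ : \sum_t eta (Num.max 0 (p t - r t)) + tv r p <= _); last first.
  by rewrite lerD2r; apply: sum_eta_le.
rewrite -sumrB -big_split/=; apply: ler_sum => t _.
have p0 := dp.1 t; have r0 := dr.1 t.
have p1 := dist_le1 t dp; have r1 := dist_le1 t dr.
have [rp|/ltW pr] := leP (r t) (p t).
- rewrite (max_r (x := 0) (y := p t - r t)) ?subr_ge0//.
  rewrite (max_l (x := 0)) ?subr_le0//.
  have := @le_eta_add _ (r t) (p t - r t) r0; rewrite subr_ge0 => /(_ rp).
  rewrite [r t + _]addrC subrK; lra.
- rewrite (max_l (x := 0) (y := p t - r t)) ?subr_le0//.
  rewrite (max_r (x := 0)) ?subr_ge0// eta0.
  by have := eta_addr_le p0 pr r1; lra.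
Qed.

Lemma gibbs T (p r : T -> R) : is_dist p -> is_dist r ->
  (forall t, r t = 0 -> p t = 0) -> 0 <= \sum_t p t * ln (p t / r t).
Proof.
move=> [p0 p1] [r0 r1] ac.
apply: le_trans (_ : \sum_t (p t - r t) <= _); first by rewrite sumrB p1 r1 subrr.
apply: ler_sum => t _.
by have := xlnx_tangent (p0 t) (r0 t) (@ac t) ltr01; rewrite ln1 mulr0 mulr1 add0r.
Qed.

Lemma cauchy_schwarz T (a b : T -> R) :
  (\sum_t a t * b t) ^+ 2 <= (\sum_t a t ^+ 2) * (\sum_t b t ^+ 2).
Proof.
set A := \sum_t a t ^+ 2; set B := \sum_t b t ^+ 2; set C := \sum_t a t * b t.
have B0 : 0 <= B by apply: sumr_ge0 => t _; exact: sqr_ge0.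
have quad (x y : R) : 0 <= x ^+ 2 * A - 2 * x * y * C + y ^+ 2 * B.
  rewrite !mulr_sumr -sumrB -big_split/=; apply: sumr_ge0 => t _.
  have := sqr_ge0 (x * a t - y * b t); lra.
have [BE|Bn0] := eqVneq B 0.
  have bE t : b t = 0.
    apply/eqP; rewrite -sqrf_eq0; apply/eqP.
    exact: (@psumr_eq0P _ _ _ _ (fun i _ => sqr_ge0 (b i)) BE).
  by rewrite BE mulr0 /C big1 ?expr0n// => t _; rewrite bE mulr0.
have Bp : 0 < B by rewrite lt_neqAle eq_sym Bn0.
have := quad B C; rewrite -(pmulr_rge0 _ Bp) => H.
have {H} : 0 <= B ^+ 2 * (A * B - C ^+ 2) by lra.
by rewrite pmulr_rge0 ?exprn_gt0// subr_ge0.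
Qed.

(* A weak Pinsker inequality, through the Hellinger distance: [ln x <= x - 1] at
   [x = sqrt (r / p)] gives [sum (sqrt p - sqrt r)^2 <= D]. *)
Lemma tv_sqr_le_divergence T (p r : T -> R) : is_dist p -> is_dist r ->
  (forall t, r t = 0 -> p t = 0) ->
  tv p r ^+ 2 <= \sum_t p t * ln (p t / r t).
Proof.
move=> dp dr ac; set D := \sum_t _.
pose u t := Num.sqrt (p t); pose v t := Num.sqrt (r t).
have u0 t : 0 <= u t by exact: sqrtr_ge0.
have v0 t : 0 <= v t by exact: sqrtr_ge0.
have uE t : p t = u t ^+ 2 by rewrite sqr_sqrtr// dp.1.
have vE t : r t = v t ^+ 2 by rewrite sqr_sqrtr// dr.1.
have su : \sum_t u t ^+ 2 = 1 by rewrite -dp.2; apply: eq_bigr => t _; rewrite uE.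
have sv : \sum_t v t ^+ 2 = 1 by rewrite -dr.2; apply: eq_bigr => t _; rewrite vE.
have hell : \sum_t `|u t - v t| ^+ 2 <= D.
  apply: le_trans (_ : \sum_t (2 * (u t ^+ 2 - u t * v t)) <= _).
    rewrite -mulr_sumr sumrB su.
    have -> : \sum_t `|u t - v t| ^+ 2
        = \sum_t (u t ^+ 2 + v t ^+ 2 - 2 * (u t * v t)).
      by apply: eq_bigr => t _; rewrite real_normK ?num_real//; ring.
    by rewrite sumrB big_split/= su sv -mulr_sumr; lra.
  apply: ler_sum => t _.
  have [ut0|un0] := eqVneq (u t) 0; first by rewrite uE ut0 expr0n/=; lra.
  have up : 0 < u t by rewrite lt_neqAle eq_sym un0 u0.
  have vp : 0 < v t.
    rewrite lt_neqAle v0 andbT eq_sym; apply: contra_neq un0 => vt0.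
    apply/eqP; rewrite -sqrf_eq0 -uE; apply/eqP/ac.
    by rewrite vE vt0 expr0n.
  have H : ln (v t / u t) <= v t / u t - 1 by apply: ln_le_sub1; rewrite divr_gt0.
  have E : ln (p t / r t) = - 2 * ln (v t / u t).
    rewrite uE vE !ln_div ?posrE ?exprn_gt0// !expr2 !lnM ?posrE//; ring.
  have : u t ^+ 2 * ln (v t / u t) <= u t ^+ 2 * (v t / u t - 1).
    by rewrite ler_wpM2l// sqr_ge0.
  have -> : u t ^+ 2 * (v t / u t - 1) = u t * v t - u t ^+ 2 by field.
  rewrite E uE; lra.
(* Twice the total variation is the L1 distance, factored for Cauchy-Schwarz; the factors [u + v]
   contribute at most 4, which cancels the square of 2. *)
have abs : 2 * tv p r = \sum_t `|u t - v t| * (u t + v t).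
  have -> : 2 * tv p r = tv p r + tv r p by rewrite (tvC dr dp); ring.
  rewrite -big_split/=; apply: eq_bigr => t _.
  rewrite -[u t + v t]ger0_norm ?addr_ge0// -normrM.
  rewrite (_ : (_ - _) * _ = p t - r t); last by rewrite uE vE; ring.
  have [h|/ltW h] := leP (r t) (p t).
  - by rewrite ger0_norm ?subr_ge0// max_r ?subr_ge0// max_l ?subr_le0// addr0.
  - by rewrite ler0_norm ?subr_le0// max_l ?subr_le0// max_r ?subr_ge0// add0r opprB.
have := cauchy_schwarz (fun t => `|u t - v t|) (fun t => u t + v t).
rewrite -abs => H.
have s4 : \sum_t (u t + v t) ^+ 2 <= 4.
  apply: le_trans (_ : \sum_t (2 * u t ^+ 2 + 2 * v t ^+ 2) <= _).
    apply: ler_sum => t _; have := sqr_ge0 (u t - v t); lra.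
  rewrite big_split/= -!mulr_sumr su sv; lra.
have D0 : 0 <= D := gibbs dp dr ac.
have s0 : 0 <= \sum_t (u t + v t) ^+ 2 by apply: sumr_ge0 => t _; exact: sqr_ge0.
have h0 : 0 <= \sum_t `|u t - v t| ^+ 2 by apply: sumr_ge0 => t _; exact: sqr_ge0.
have : (\sum_t `|u t - v t| ^+ 2) * (\sum_t (u t + v t) ^+ 2) <= D * 4.
  by rewrite ler_pM.
lra.
Qed.

End Entropy.

(** * Marginals, channels and mutual information *)

Section MutualInformation.
Context {R : realType} (X Y : finType).
Implicit Types (p : X -> R) (q : X * Y -> R) (V : X -> Y -> R).

Lemma eta_sum_le (T : finType) (a : T -> R) : (forall t, 0 <= a t) ->
  eta (\sum_t a t) <= \sum_t eta (a t).
Proof.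
move=> a0; suff [] : 0 <= \sum_t a t /\ eta (\sum_t a t) <= \sum_t eta (a t) by [].
elim/big_ind2 : _ => [|x u y v [x0 xu] [y0 yv]|t _]; rewrite ?eta0//.
by split; [exact: addr_ge0|apply: le_trans (le_eta_add x0 y0) _; exact: lerD].
Qed.

Lemma sum_pair (F : X * Y -> R) : \sum_z F z = \sum_x \sum_y F (x, y).
Proof. by rewrite pair_bigA; apply: eq_bigr => -[]. Qed.

Lemma sum_pair_exchange (F : X * Y -> R) : \sum_z F z = \sum_y \sum_x F (x, y).
Proof. by rewrite sum_pair exchange_big. Qed.

Lemma marginalX_dist q : is_dist q -> is_dist (marginalX q).
Proof.
move=> [q0 q1]; split; first by move=> x; exact: sumr_ge0.
by rewrite -q1 sum_pair.
Qed.

Lemma marginalY_dist q : is_dist q -> is_dist (marginalY q).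
Proof.
move=> [q0 q1]; split; first by move=> x; exact: sumr_ge0.
by rewrite -q1 sum_pair_exchange.
Qed.

Lemma marginalX_joint p V : is_channel V -> marginalX (joint p V) = p.
Proof.
move=> cV; apply/funext => x; rewrite /marginalX /joint/= -mulr_sumr.
by rewrite (cV x).2 mulr1.
Qed.

Lemma joint_dist p V : is_dist p -> is_channel V -> is_dist (joint p V).
Proof.
move=> dp cV; split; first by move=> z; rewrite mulr_ge0 ?dp.1 ?(cV _).1.
rewrite sum_pair -[RHS]dp.2; apply: eq_bigr => x _.
by rewrite /joint/= -mulr_sumr (cV x).2 mulr1.
Qed.

Lemma le_marginalX q z : (forall z, 0 <= q z) -> q z <= marginalX q z.1.
Proof.
case: z => x y q0; rewrite /marginalX (bigD1 y)//= lerDl; exact: sumr_ge0.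
Qed.

Lemma le_marginalY q z : (forall z, 0 <= q z) -> q z <= marginalY q z.2.
Proof.
case: z => x y q0; rewrite /marginalY (bigD1 x)//= lerDl; exact: sumr_ge0.
Qed.

Lemma marginals_eq0 q z : (forall z, 0 <= q z) ->
  marginalX q z.1 * marginalY q z.2 = 0 -> q z = 0.
Proof.
move=> q0 /eqP; rewrite mulf_eq0 => /orP[|] /eqP m0; apply/eqP;
  rewrite eq_le q0 andbT -m0; [exact: le_marginalX|exact: le_marginalY].
Qed.

Lemma dist_jointE q : is_dist q ->
  exists V, is_channel V /\ q = joint (marginalX q) V.
Proof.
move=> dq; have q0 := dq.1.
(* On inputs of zero mass any output distribution would do; the output marginal is one at hand. *)
exists (fun x y => if marginalX q x == 0 then marginalY q y
                   else q (x, y) / marginalX q x); split.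
- move=> x; have [_|xn0] := eqVneq (marginalX q x) 0; first exact: marginalY_dist.
  split; first by move=> y; rewrite divr_ge0//; exact: sumr_ge0.
  by rewrite -mulr_suml divff.
- apply/funext => -[x y]; rewrite /joint/=; case: ifPn => [/eqP x0|xn0].
    rewrite x0 mul0r; apply: marginals_eq0 => //=; by rewrite x0 mul0r.
  by rewrite mulrC divfK.
Qed.

Lemma mutual_infoE q : (forall z, 0 <= q z) ->
  mutual_info q = entropy (marginalX q) + entropy (marginalY q) - entropy q.
Proof.
move=> q0.
have -> : entropy (marginalX q) = \sum_z - (q z * ln (marginalX q z.1)).
  rewrite sum_pair; apply: eq_bigr => x _.
  by rewrite /eta/= sumrN -mulr_suml.
have -> : entropy (marginalY q) = \sum_z - (q z * ln (marginalY q z.2)).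
  rewrite sum_pair_exchange; apply: eq_bigr => y _.
  by rewrite /eta/= sumrN -mulr_suml.
rewrite -big_split/= -sumrB; apply: eq_bigr => z _.
have [->|qn0] := eqVneq (q z) 0; first by rewrite eta0 !mul0r; ring.
have qp : 0 < q z by rewrite lt_neqAle eq_sym qn0 q0.
have xp := lt_le_trans qp (le_marginalX z q0).
have yp := lt_le_trans qp (le_marginalY z q0).
by rewrite /eta ln_div ?posrE ?mulr_gt0// lnM ?posrE//; ring.
Qed.

Lemma mutual_info_ge0 q : is_dist q -> 0 <= mutual_info q.
Proof.
move=> dq; have [x0 x1] := marginalX_dist dq; have [y0 y1] := marginalY_dist dq.
apply: (@gibbs _ _ q (fun z => marginalX q z.1 * marginalY q z.2)) => //.
- split; first by move=> z; exact: mulr_ge0.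
  rewrite sum_pair/= -x1; apply: eq_bigr => x _.
  by rewrite -mulr_sumr y1 mulr1.
- by move=> z; apply: marginals_eq0; exact: dq.1.
Qed.

(** By subadditivity of [eta] neither marginal entropy exceeds the joint entropy, so what remains of
    the entropy formula is at most the other marginal entropy. *)
Lemma mutual_info_le q : is_dist q ->
  mutual_info q <= Num.min (ln #|X|%:R) (ln #|Y|%:R).
Proof.
move=> dq; have q0 := dq.1; rewrite mutual_infoE//.
have hX : entropy (marginalX q) <= entropy q.
  by rewrite {2}/entropy sum_pair; apply: ler_sum => x _; exact: eta_sum_le.
have hY : entropy (marginalY q) <= entropy q.
  by rewrite {2}/entropy sum_pair_exchange; apply: ler_sum => x _; exact: eta_sum_le.
have := entropy_le (marginalX_dist dq); have := entropy_le (marginalY_dist dq).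
by rewrite le_min => ? ?; apply/andP; split; lra.
Qed.

Lemma entropy_joint p V : is_dist p -> is_channel V ->
  entropy (joint p V) = entropy p + \sum_x p x * entropy (V x).
Proof.
move=> dp cV; rewrite {1}/entropy sum_pair -big_split/=.
apply: eq_bigr => x _.
have -> : eta (p x) = \sum_y V x y * eta (p x).
  by rewrite -mulr_suml (cV x).2 mul1r.
rewrite mulr_sumr -big_split/=; apply: eq_bigr => y _.
rewrite /joint/= /eta.
have [->|pn0] := eqVneq (p x) 0; first by rewrite !mul0r; ring.
have [->|vn0] := eqVneq (V x y) 0; first by rewrite mulr0 !mul0r; ring.
have pp : 0 < p x by rewrite lt_neqAle eq_sym pn0 dp.1.
have vp : 0 < V x y by rewrite lt_neqAle eq_sym vn0 (cV x).1.
by rewrite lnM ?posrE//; ring.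
Qed.

(** Data processing: the positive part of a sum is at most the sum of the positive parts. *)
Lemma tv_marginalY q r : tv (marginalY q) (marginalY r) <= tv q r.
Proof.
rewrite {2}/tv sum_pair_exchange; apply: ler_sum => y _.
rewrite ge_max; apply/andP; split.
  by apply: sumr_ge0 => x _; rewrite le_max lexx.
by rewrite /marginalY -sumrB; apply: ler_sum => x _; rewrite le_max lexx orbT.
Qed.

Lemma tv_joint p r V : is_channel V -> tv (joint p V) (joint r V) = tv p r.
Proof.
move=> cV; rewrite {1}/tv sum_pair; apply: eq_bigr => x _.
rewrite -[RHS]mulr1 -(cV x).2 mulr_sumr; apply: eq_bigr => y _.
have v0 := (cV x).1 y; rewrite /joint/= -mulrBl.
by rewrite maxr_pMl// mul0r.
Qed.

(* The conditional entropy [H(Y|X)] is linear in the input distribution once the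
   channel is fixed, so only the entropy of the output costs a logarithm. *)
Lemma mutual_info_sub_le p r V : is_dist p -> is_dist r -> is_channel V ->
  mutual_info (joint p V) - mutual_info (joint r V)
    <= eta (tv p r) + tv p r + 2 * tv p r * ln #|Y|%:R.
Proof.
move=> dp dr cV.
have jp := joint_dist dp cV; have jr := joint_dist dr cV.
have yp := marginalY_dist jp; have yr := marginalY_dist jr.
rewrite (mutual_infoE jp.1) (mutual_infoE jr.1) !marginalX_joint//.
rewrite !entropy_joint//.
set s := tv (marginalY (joint p V)) (marginalY (joint r V)).
have st : s <= tv p r by rewrite -(tv_joint p r cV); exact: tv_marginalY.
have s0 : 0 <= s := tv_ge0 _ _.
have H1 := entropy_sub_le yp yr; rewrite -/s in H1.
have H2 := eta_addr_le s0 st (tv_le1 dp dr).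
have L0 := dist_ln_card_ge0 yp.
have H3 : s * ln #|Y|%:R <= tv p r * ln #|Y|%:R by exact: ler_wpM2r.
have H4 : \sum_x r x * entropy (V x) - \sum_x p x * entropy (V x)
    <= tv r p * ln #|Y|%:R.
  apply: sum_diff_le_tv => x; first exact: entropy_ge0.
  exact: entropy_le.
rewrite (tvC dr dp) in H4; lra.
Qed.

(** Joint convexity of [a ln (a / b)]: both tangents are taken at the common ratio [u / v], and
    their weighted sum is exactly [u ln (u / v)]. *)
Lemma xlnx_div_convex (a a' b b' t u v : R) :
  0 <= a -> 0 <= a' -> 0 <= b -> 0 <= b' ->
  (b = 0 -> a = 0) -> (b' = 0 -> a' = 0) -> 0 <= t -> t <= 1 ->
  u = (1 - t) * a + t * a' -> v = (1 - t) * b + t * b' ->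
  u * ln (u / v) <= (1 - t) * (a * ln (a / b)) + t * (a' * ln (a' / b')).
Proof.
move=> a0 a'0 b0 b'0 ba ba' t0 t1 uE vE.
have t1' : 0 <= 1 - t by lra.
have ta0 : 0 <= (1 - t) * a by exact: mulr_ge0.
have ta'0 : 0 <= t * a' by exact: mulr_ge0.
have tb0 : 0 <= (1 - t) * b by exact: mulr_ge0.
have tb'0 : 0 <= t * b' by exact: mulr_ge0.
have [u0|un0] := eqVneq u 0.
  have -> : u * ln (u / v) = 0 by rewrite u0 mul0r.
  rewrite !mulrA.
  have -> : (1 - t) * a = 0 by lra.
  have -> : t * a' = 0 by lra.
  by rewrite !mul0r addr0.
have up : 0 < u by rewrite lt_neqAle eq_sym un0 uE addr_ge0.
have vp : 0 < v.
  rewrite lt_neqAle eq_sym vE addr_ge0// andbT -vE; apply: contra_neq un0 => v0.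
  have /eqP : (1 - t) * b = 0 by lra.
  have /eqP : t * b' = 0 by lra.
  rewrite !mulf_eq0 uE => /orP[|]/eqP h' /orP[|]/eqP h.
  - by rewrite h' in h; lra.
  - by rewrite h' (ba h) mulr0 mul0r addr0.
  - by rewrite h (ba' h') mul0r mulr0 addr0.
  - by rewrite (ba h) (ba' h') !mulr0 addr0.
have cp : 0 < u / v by rewrite divr_gt0.
have h1 := ler_wpM2l t1' (xlnx_tangent a0 b0 ba cp).
have h2 := ler_wpM2l t0 (xlnx_tangent a'0 b'0 ba' cp).
apply: le_trans (lerD h1 h2).
have e : u = v * (u / v) by field; rewrite gt_eqF.
rewrite le_eqVlt; apply/orP; left; apply/eqP.
transitivity (u * ln (u / v) + u - v * (u / v)); first by rewrite -e addrK.
by rewrite {1 3}uE {2}vE; ring.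
Qed.

(** With the input fixed, the joint distribution and the product of its marginals are both affine in
    the channel, so joint convexity applies termwise. *)
Lemma mutual_info_convex p V W (t : R) : is_dist p -> is_channel V ->
  is_channel W -> 0 <= t -> t <= 1 ->
  mutual_info (joint p (fun x y => (1 - t) * V x y + t * W x y))
    <= (1 - t) * mutual_info (joint p V) + t * mutual_info (joint p W).
Proof.
move=> dp cV cW t0 t1.
have cU : is_channel (fun x y => (1 - t) * V x y + t * W x y).
  move=> x; split.
    by move=> y; rewrite addr_ge0// mulr_ge0 ?(cV x).1 ?(cW x).1//; lra.
  by rewrite big_split/= -!mulr_sumr (cV x).2 (cW x).2; ring.
rewrite /mutual_info !marginalX_joint// !mulr_sumr -big_split/=.
have [jV _] := joint_dist dp cV; have [jW _] := joint_dist dp cW.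
have yE y : marginalY (joint p (fun x y => (1 - t) * V x y + t * W x y)) y
    = (1 - t) * marginalY (joint p V) y + t * marginalY (joint p W) y.
  rewrite /marginalY !mulr_sumr -big_split/=; apply: eq_bigr => x _.
  by rewrite /joint/=; ring.
apply: ler_sum => -[x y] _ /=; rewrite yE mulrDr !(mulrCA (p x)).
have -> : joint p (fun x y => (1 - t) * V x y + t * W x y) (x, y)
   = (1 - t) * joint p V (x, y) + t * joint p W (x, y).
  by rewrite /joint/=; ring.
have [p0 _] := dp.
apply: xlnx_div_convex => //.
- by rewrite mulr_ge0//; exact: sumr_ge0.
- by rewrite mulr_ge0//; exact: sumr_ge0.
- have := @marginals_eq0 (joint p V) (x, y) jV.
  by rewrite marginalX_joint.
- have := @marginals_eq0 (joint p W) (x, y) jW.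
  by rewrite marginalX_joint.
Qed.

End MutualInformation.

(** * Convexity and slope of the rate distortion function *)

Section RateDistortion.
Context {R : realType} (X Y : finType).
Variables (P : X -> R) (d : X -> Y -> R).
Hypotheses (P_dist : is_dist P) (d_ge0 : forall x y, 0 <= d x y).
Hypothesis d_zero : forall x, exists y, d x y = 0.

Local Notation alpha := (Num.min (ln (#|X|%:R : R)) (ln (#|Y|%:R : R))).
Local Notation rd := (rate_distortion P d).

Definition feasible (D : R) (V : X -> Y -> R) : Prop :=
  is_channel V /\ expected_distortion d (joint P V) <= D.

Lemma zero_letter : exists y0 : X -> Y, forall x, d x (y0 x) = 0.
Proof. by have [y0] := choice d_zero; exists y0. Qed.

Lemma feasible_exists (D : R) : 0 <= D -> exists V, feasible D V.
Proof.
move=> D0; have [y0 y0E] := zero_letter.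
exists (fun x y => (y == y0 x)%:R); split.
- move=> x; split; first by move=> y; exact: ler0n.
  by rewrite (bigD1 (y0 x))//= eqxx big1 ?addr0// => y /negPf ->.
- rewrite /expected_distortion big1// => -[x y] _ /=; rewrite /joint/=.
  by case: eqVneq => [->|_]; rewrite ?y0E ?mulr0// mul0r.
Qed.

Lemma mutual_info_feasible_ge0 V D : feasible D V -> 0 <= mutual_info (joint P V).
Proof. by move=> [cV _]; exact/mutual_info_ge0/joint_dist. Qed.

Let rates D := [set mutual_info (joint P V) | V in feasible D].

Lemma has_inf_rates D : 0 <= D -> has_inf (rates D).
Proof.
move=> D0; split.
  by have [V fV] := feasible_exists D0; exists (mutual_info (joint P V)); exists V.
by exists 0 => _ [V fV <-]; exact: mutual_info_feasible_ge0 fV.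
Qed.

Lemma rate_distortion_le D V : feasible D V -> rd D <= mutual_info (joint P V).
Proof.
move=> fV; apply: ge_inf; last by exists V.
by exists 0 => _ [W fW <-]; exact: mutual_info_feasible_ge0 fW.
Qed.

(** Near-optimal channels take the place of minimizers, up to an arbitrary slack [e]. *)
Lemma rate_distortion_adherent D e : 0 <= D -> 0 < e ->
  exists2 V, feasible D V & mutual_info (joint P V) < rd D + e.
Proof.
move=> D0 e0; have [_ [V fV <-] lt] := inf_adherent e0 (has_inf_rates D0).
by exists V.
Qed.

Lemma rate_distortion_ge0 D : 0 <= D -> 0 <= rd D.
Proof.
move=> D0; apply: lb_le_inf; first exact: (has_inf_rates D0).1.
by move=> _ [V fV <-]; exact: mutual_info_feasible_ge0 fV.
Qed.

Lemma rate_distortion_le_alpha D : 0 <= D -> rd D <= alpha.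
Proof.
move=> D0; have [V fV] := feasible_exists D0.
apply: le_trans (rate_distortion_le fV) _.
exact/mutual_info_le/joint_dist/fV.1.
Qed.

(** Expected distortion is linear in the channel, so a mixture of near-optimal channels is feasible
    at the mixed level. *)
Lemma rate_distortion_convex D E t : 0 <= D -> 0 <= E -> 0 <= t -> t <= 1 ->
  rd ((1 - t) * D + t * E) <= (1 - t) * rd D + t * rd E.
Proof.
move=> D0 E0 t0 t1; apply/ler_addgt0Pr => e e0.
have [V [cV dV] lV] := rate_distortion_adherent D0 e0.
have [W [cW dW] lW] := rate_distortion_adherent E0 e0.
have t1' : 0 <= 1 - t by lra.
apply: le_trans (_ : (1 - t) * mutual_info (joint P V)
    + t * mutual_info (joint P W) <= _); last first.
  by have := ler_wpM2l t1' (ltW lV); have := ler_wpM2l t0 (ltW lW); lra.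
apply: le_trans _ (mutual_info_convex P_dist cV cW t0 t1).
apply: rate_distortion_le; split.
  move=> x; split.
    by move=> y; rewrite addr_ge0// mulr_ge0 ?(cV x).1 ?(cW x).1.
  by rewrite big_split/= -!mulr_sumr (cV x).2 (cW x).2; ring.
apply: le_trans (lerD (ler_wpM2l t1' dV) (ler_wpM2l t0 dW)).
rewrite /expected_distortion !mulr_sumr -big_split/= le_eqVlt.
by apply/orP; left; apply/eqP; apply: eq_bigr => z _; rewrite /joint; ring.
Qed.

(** By convexity the chord from [D] to [D + h] is at least as steep as the right derivative at
    [D]. *)
Lemma rate_distortion_slope D (R' h : R) : 0 <= D -> 0 <= h ->
  has_derivative_on [set t | 0 <= t] rd D R' ->
  rd D <= rd (D + h) + `|R'| * h.
Proof.
move=> D0; rewrite le_eqVlt => /predU1P[<- _|h0 der].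
  by rewrite addr0 mulr0 addr0.
suff : R' <= h^-1 * (rd (D + h) - rd D).
  rewrite -(ler_pM2l h0) mulrA divff ?gt_eqF// mul1r => H.
  have := ler_norm (- R'); rewrite normrN -(ler_pM2r h0); lra.
(* Approaching from the right keeps [D + u] in the domain, also when [D = 0]. *)
have der' : u^-1 * (rd (D + u) - rd D) @[u --> 0^'+] --> R'.
  apply: cvg_trans der; apply: cvg_app => A.
  rewrite /within/= /at_right /dnbhs /within/=.
  apply: (@filterS _ (nbhs (0 : R))) => u Au u0; apply: Au; first by rewrite gt_eqF.
  by rewrite addr_ge0// ltW.
apply: (cvgr_to_le der'); near=> u.
have u0 : 0 < u by near: u; exact: nbhs_right_gt.
have uh : u <= h by near: u; exact: nbhs_right_le.
have c : rd (D + u) <= (1 - u / h) * rd D + u / h * rd (D + h).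
  rewrite (_ : D + u = (1 - u / h) * D + u / h * (D + h)); last first.
    by field; rewrite gt_eqF.
  apply: rate_distortion_convex => //; first by rewrite addr_ge0// ltW.
    by rewrite divr_ge0// ltW.
  by rewrite ler_pdivrMr// mul1r.
rewrite -(ler_pM2l u0) mulrA divff ?gt_eqF// mul1r; lra.
Unshelve. all: by end_near.
Qed.

(** * Right continuity of the rate distortion function *)

Lemma distortion_bounded_below :
  exists2 K : R, 0 < K & forall x y, d x y != 0 -> 1 <= K * d x y.
Proof.
(* Since the inverse of 0 is 0, only positive distortions contribute, and [S] dominates the inverse
   of each of them. *)
pose S : R := \sum_(z : X * Y) (d z.1 z.2)^-1.
have inv0 (z : X * Y) : 0 <= (d z.1 z.2)^-1 by rewrite invr_ge0.
have S0 : 0 <= S by exact: sumr_ge0.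
exists (S + 1) => [|x y dn0]; first lra.
have dp : 0 < d x y by rewrite lt_neqAle eq_sym dn0 d_ge0.
have leS : (d x y)^-1 <= S.
  by rewrite /S (bigD1 (x, y))//= lerDl; exact: sumr_ge0.
by have := ler_wpM2r (ltW dp) leS; rewrite mulVf//; lra.
Qed.

(* Redirecting the mass that a channel puts on letters of positive distortion to
   the zero-distortion letters moves at most [K h] of the joint distribution. *)
Lemma rate_distortion0_le (K h : R) :
  0 < K -> (forall x y, d x y != 0 -> 1 <= K * d x y) -> 0 <= h -> K * h <= 1 ->
  rd 0 <= rd h + 2 * (eta (K * h) + K * h)
          + K * h * (ln #|Y|%:R + ln #|{: X * Y}|%:R).
Proof.
move=> K0 KP h0 Kh1; apply/ler_addgt0Pr => e e0.
have [V [cV dV] lV] := rate_distortion_adherent h0 e0.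
have [y0 y0E] := zero_letter; have [p0 _] := P_dist.
pose bad x := \sum_(y | d x y != 0) V x y.
pose W x y := (if d x y == 0 then V x y else 0) + (y == y0 x)%:R * bad x.
have V0 x y : 0 <= V x y := (cV x).1 y.
have bad0 x : 0 <= bad x by exact: sumr_ge0.
have cW : is_channel W.
  move=> x; split.
    move=> y; rewrite addr_ge0//; first by case: ifP.
    by rewrite mulr_ge0// ler0n.
  rewrite big_split/= -mulr_suml.
  rewrite [X in _ + X * _](_ : _ = 1) ?mul1r; last first.
    by rewrite (bigD1 (y0 x))//= eqxx big1 ?addr0// => y /negPf ->.
  by rewrite -big_mkcond/= -(cV x).2 [RHS](bigID (fun y => d x y == 0)).
have fW : feasible 0 W.
  split=> //; rewrite /expected_distortion big1// => -[x y] _.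
  rewrite /joint /W/=; case: eqVneq => [->|dn0]; first by rewrite mulr0.
  case: eqVneq => [yE|_]; first by rewrite yE y0E eqxx in dn0.
  by rewrite mul0r addr0 mulr0 mul0r.
have jV := joint_dist P_dist cV; have jW := joint_dist P_dist cW.
set T := tv (joint P V) (joint P W).
(* On zero-distortion letters [W] only adds mass, so the positive part lives on the others, where it
   is at most [K * d] times the mass under [V]. *)
have TK : T <= K * h.
  apply: le_trans (ler_wpM2l (ltW K0) dV).
  rewrite /T /tv /expected_distortion mulr_sumr; apply: ler_sum => -[x y] _ /=.
  have q0 : 0 <= joint P V (x, y) by exact: jV.1.
  rewrite ge_max; apply/andP; split.
    by rewrite mulr_ge0 ?mulr_ge0// ltW.
  have [d0|dn0] := eqVneq (d x y) 0.
    rewrite d0 !mulr0 subr_le0 /joint/= ler_wpM2l// /W d0 eqxx lerDl.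
    by rewrite mulr_ge0// ler0n.
  have : 0 <= joint P W (x, y) by exact: jW.1.
  have := ler_wpM2l q0 (KP x y dn0); lra.
have T0 : 0 <= T := tv_ge0 _ _.
set T' := tv (marginalY (joint P W)) (marginalY (joint P V)).
have T'T : T' <= T by rewrite /T (tvC jV jW); exact: tv_marginalY.
have T'0 : 0 <= T' := tv_ge0 _ _.
have yV := marginalY_dist jV; have yW := marginalY_dist jW.
(* The input entropies agree, so the informations differ through output and joint entropies only;
   each costs one continuity bound, whence the factor 2. *)
have h1 := entropy_sub_le yW yV; have h2 := entropy_sub_le jV jW.
rewrite -/T' in h1; rewrite -/T in h2.
have T'K : T' <= K * h by exact: le_trans TK.
have e1 := eta_addr_le T0 TK Kh1; have e2 := eta_addr_le T'0 T'K Kh1.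
have l1 := ler_wpM2r (dist_ln_card_ge0 yV) T'K.
have l2 := ler_wpM2r (dist_ln_card_ge0 jV) TK.
apply: le_trans (rate_distortion_le fW) _.
move: lV; rewrite (mutual_infoE jV.1) (mutual_infoE jW.1) !marginalX_joint//.
move=> lV; lra.
Qed.

(** For [D > 0], write [D] as a mixture of [D + h] and 0 and bound the rate at 0 by [alpha]. At
    [D = 0] the error of the redirection bound vanishes with [h]. *)
Lemma rate_distortion_right_continuous D e : 0 <= D -> 0 < e ->
  exists2 r : R, 0 < r & forall h, 0 <= h -> h <= r -> rd D <= rd (D + h) + e.
Proof.
rewrite le_eqVlt => /predU1P[<-|D0] e0; last first.
  have a0 : 0 <= alpha.
    by apply: le_trans (rate_distortion_ge0 (lexx 0)) (rate_distortion_le_alpha _).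
  exists (e * D / (alpha + 1)); first by rewrite divr_gt0 ?mulr_gt0//; lra.
  move=> h h0; rewrite ler_pdivlMr; last lra.
  move=> hr; have Dh : 0 < D + h by lra.
  pose t := h / (D + h).
  have t0 : 0 <= t by rewrite divr_ge0// ltW.
  have t1 : t <= 1 by rewrite ler_pdivrMr// mul1r; lra.
  have := rate_distortion_convex (ltW Dh) (lexx 0) t0 t1.
  have -> : (1 - t) * (D + h) + t * 0 = D by rewrite /t; field; rewrite gt_eqF.
  have := ler_wpM2l t0 (rate_distortion_le_alpha (lexx 0)).
  have : 0 <= t * rd (D + h).
    by rewrite mulr_ge0// rate_distortion_ge0// ltW.
  have : t * alpha <= e.
    rewrite mulrAC ler_pdivrMr//.
    have : 0 <= e * h by rewrite mulr_ge0// ltW.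
    lra.
  lra.
have [K K0 KP] := distortion_bounded_below.
set L : R := ln #|Y|%:R + ln #|{: X * Y}|%:R.
have L0 : 0 <= L.
  have [V [cV _]] := feasible_exists (lexx 0).
  have jV := joint_dist P_dist cV.
  by rewrite addr_ge0// (dist_ln_card_ge0 jV, dist_ln_card_ge0 (marginalY_dist jV)).
(* [c] will bound [sqrt (K * h)]; as [K * h <= c ^+ 2 <= c], the error is at most
   [2 * (2 * c + c) + c * L = c * (6 + L)]. *)
set c := Num.min 1 (e / (6 + L)).
have c0 : 0 < c by rewrite lt_min ltr01/= divr_gt0//; lra.
exists (c ^+ 2 / K) => [|h h0]; first by rewrite divr_gt0 ?exprn_gt0.
rewrite ler_pdivlMr// mulrC => hc.
have c1 : c <= 1 by rewrite ge_min lexx.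
have ce : c * (6 + L) <= e.
  by rewrite -ler_pdivlMr; [rewrite ge_min lexx orbT | lra].
have Kh0 : 0 <= K * h by rewrite mulr_ge0// ltW.
have Kh1 : K * h <= 1 by apply: le_trans hc _; rewrite exprn_ile1// ltW.
have := rate_distortion0_le K0 KP h0 Kh1.
have sc : Num.sqrt (K * h) <= c.
  by rewrite -(ler_pXn2r (n := 2))// ?nnegrE ?sqrtr_ge0 ?sqr_sqrtr// ltW.
have := eta_le_sqrt Kh0.
have cc : c ^+ 2 <= c by rewrite expr2 -[leRHS]mulr1 ler_wpM2l// ltW.
have := ler_wpM2r L0 (le_trans hc cc).
rewrite add0r -/L; lra.
Qed.

(** * Comparison of the cutoff rate with the rate distortion function *)

Lemma expected_distortion_sub_le p r V : is_dist p -> is_dist r -> is_channel V ->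
  expected_distortion d (joint p V) - expected_distortion d (joint r V)
    <= tv p r * dmax d.
Proof.
move=> dp dr cV; rewrite -(tv_joint p r cV).
apply: sum_diff_le_tv => -[x y] //=.
exact: (le_bigmax 0 (fun z : X * Y => d z.1 z.2) (x, y)).
Qed.

Lemma dmax_ge0 : 0 <= dmax d.
Proof. by rewrite /dmax; elim/big_ind : _ => // x y x0 _; rewrite le_max x0. Qed.

Lemma KL_ge0 (T : finType) (p r : T -> R) : is_dist p -> is_dist r ->
  (0 <= KL p r)%E.
Proof.
move=> dp dr; rewrite /KL; case: ifPn => [/forallP ac|_]; last exact: le0y.
by rewrite lee_fin gibbs// => t /eqP rt; apply/eqP; move: (ac t); rewrite rt.
Qed.

Lemma KLpp (T : finType) (p : T -> R) : KL p p = 0%E.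
Proof.
rewrite /KL ifT; last by apply/forallP => t; apply/implyP.
rewrite big1// => t _; have [->|pn0] := eqVneq (p t) 0; first by rewrite mul0r.
by rewrite divff// ln1 mulr0.
Qed.

Lemma cutoff_rate_ge0 D l : 0 < l -> (0 <= cutoff_rate P d D l)%E.
Proof.
move=> l0; apply: le_ereal_inf_tmp => _ [q [dq _] <-].
rewrite adde_ge0 ?lee_fin ?mutual_info_ge0// mule_ge0 ?lee_fin ?divr_ge0 ?(ltW l0)//.
by apply: KL_ge0 => //; exact: marginalX_dist.
Qed.

(** The inequality holds for each [q] separately, the divergence being nonnegative. *)
Lemma cutoff_rate_antitone D l1 l2 : 0 < l1 -> l1 <= l2 ->
  (cutoff_rate P d D l2 <= cutoff_rate P d D l1)%E.
Proof.
move=> l1_gt0 l12; apply: le_ereal_inf_tmp => _ [q [dq Dq] <-].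
apply: ge_ereal_inf; eexists; first by exists q.
apply: leeD => //; apply: lee_wpmul2r.
  by apply: KL_ge0 => //; exact: marginalX_dist.
by rewrite lee_fin !div1r lef_pV2 ?posrE// (lt_le_trans l1_gt0).
Qed.

(** A joint distribution with input marginal [P] has zero divergence term. *)
Lemma cutoff_rate_le D l : 0 <= D ->
  (cutoff_rate P d D l <= (rd D)%:E)%E.
Proof.
move=> D0; apply/lee_addgt0Pr => e e0.
have [V [cV dV] lV] := rate_distortion_adherent D0 e0.
apply: ge_ereal_inf; eexists.
  by exists (joint P V); first by split => //; exact: joint_dist.
by rewrite marginalX_joint// KLpp mule0 adde0 -EFinD lee_fin ltW.
Qed.

(* If [q] beats the rate [rd D], its divergence term is at most [l * alpha], so
   its input marginal is [theta]-close to [P]; the channel of [q] used with input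
   [P] then exceeds the distortion level by at most [dmax * theta]. *)
Lemma cutoff_rate_ge D l theta B : 0 <= D -> 0 < l -> 0 <= theta -> theta <= 1 ->
  alpha * l <= theta ^+ 2 -> 0 <= B -> rd D <= rd (D + dmax d * theta) + B ->
  ((rd D - (B + eta theta + theta + 2 * theta * ln #|Y|%:R))%:E
     <= cutoff_rate P d D l)%E.
Proof.
move=> D0 l0 th0 th1 alth B0 gap; apply: le_ereal_inf_tmp => _ [q [dq Dq] <-].
have [V [cV qE]] := dist_jointE dq; have dx := marginalX_dist dq.
have lnY0 := dist_ln_card_ge0 (marginalY_dist dq).
have I0 := mutual_info_ge0 dq.
have eth := eta_ge0 th0 th1.
have thl : 0 <= theta * ln #|Y|%:R by rewrite mulr_ge0.
rewrite /KL; case: ifPn => [/forallP ac|_]; last first.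
  by rewrite mulry gtr0_sg ?divr_gt0// mul1e addey// leey.
have ac' x : P x = 0 -> marginalX q x = 0.
  by move=> /eqP Px; apply/eqP; move: (ac x); rewrite Px.
set KLq := \sum_x _; rewrite -EFinM -EFinD lee_fin.
have K0 : 0 <= KLq := gibbs dx P_dist ac'.
have -> : 1 / l * KLq = KLq / l by rewrite mul1r mulrC.
have [big|small] := leP (rd D) (mutual_info q + KLq / l).
  by apply: (le_trans _ big); lra.
have Kl : KLq <= alpha * l.
  rewrite -ler_pdivrMr//; apply: (le_trans _ (rate_distortion_le_alpha D0)); lra.
have Kl0 : 0 <= KLq / l by rewrite divr_ge0// ltW.
set T := tv P (marginalX q).
have T0 : 0 <= T := tv_ge0 _ _.
have Tth : T <= theta.
  rewrite -(ler_pXn2r (n := 2))// ?nnegrE// /T (tvC P_dist dx).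
  apply: le_trans (tv_sqr_le_divergence dx P_dist ac') _.
  exact: le_trans Kl alth.
have fV : feasible (D + dmax d * theta) V.
  split=> //; have := expected_distortion_sub_le P_dist dx cV.
  rewrite -qE -/T; have := ler_wpM2r dmax_ge0 Tth; lra.
have H := rate_distortion_le fV.
have H2 := mutual_info_sub_le P_dist dx cV; rewrite -qE -/T in H2.
have H3 := eta_addr_le T0 Tth th1.
have H4 := ler_wpM2r lnY0 Tth.
lra.
Qed.

End RateDistortion.

(** * Monotonicity, the explicit bound and the limit *)

Theorem proposition2 (R : realType) (X Y : finType)
    (P : X -> R) (d : X -> Y -> R) (Delta : R)
    (P_dist : is_dist P)
    (d_ge0 : forall x y, 0 <= d x y)
    (d_zero : forall x, exists y, d x y = 0)
    (Delta_ge0 : 0 <= Delta) :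
  let nX : R := #|X|%:R in
  let nY : R := #|Y|%:R in
  let alpha : R := Num.min (ln nX) (ln nY) in
  [/\ (* monotonicity *)
      (forall lambda1 lambda2 : R,
         0 < lambda1 -> lambda1 <= lambda2 -> lambda2 <= 1 ->
         (cutoff_rate P d Delta lambda2 <= cutoff_rate P d Delta lambda1)%E),
      (* two-sided bound for 0 < lambda <= 1 / (8 alpha) *)
      (forall lambda : R, 0 < lambda -> 8 * alpha * lambda <= 1 ->
         (0 <= (rate_distortion P d Delta)%:E - cutoff_rate P d Delta lambda)%E
         /\
         forall R' : R,
           has_derivative_on [set t | 0 <= t] (rate_distortion P d) Delta R' ->
           let c1 : R := 3 / 2 * Num.sqrt (2 * alpha) in
           let c2 : R := 4 / 3 * ln (nX * nY) - ln (2 * alpha)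
                         + 2 / 3 * dmax d * `|R'| in
           ((rate_distortion P d Delta)%:E - cutoff_rate P d Delta lambda
              <= (c1 * Num.sqrt lambda * (ln lambda^-1 + c2))%:E)%E)
    & (* limit *)
      cutoff_rate P d Delta lambda @[lambda --> 0^'+]
        --> (rate_distortion P d Delta)%:E].
Proof.
move=> nX nY alpha.
have [V [cV _]] := feasible_exists P d_zero Delta_ge0.
have yV := marginalY_dist (joint_dist P_dist cV).
have nX0 : 0 < nX by rewrite ltr0n (dist_card_gt0 P_dist).
have nY0 : 0 < nY by rewrite ltr0n (dist_card_gt0 yV).
have lnX0 : 0 <= ln nX := dist_ln_card_ge0 P_dist.
have lnY0 : 0 <= ln nY := dist_ln_card_ge0 yV.
have alpha0 : 0 <= alpha by rewrite le_min lnX0.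
have dm0 := dmax_ge0 d_ge0.
have cfin lambda : 0 < lambda -> cutoff_rate P d Delta lambda \is a fin_num.
  move=> l0; rewrite ge0_fin_numE ?cutoff_rate_ge0//.
  by apply: le_lt_trans (cutoff_rate_le P_dist d_zero lambda Delta_ge0) (ltry _).
split.
- by move=> l1 l2 l1_gt0 l12 _; exact: cutoff_rate_antitone.
- move=> lambda l0 l8; split.
    by rewrite sube_ge0 ?cfin// cutoff_rate_le.
  move=> R' der; cbv zeta.
  set c1 := 3 / 2 * _; set c2 := _ + 2 / 3 * dmax d * _.
  (* This choice makes [c1 * sqrt lambda] equal to [3 / 2 * theta], and [8 * alpha * lambda <= 1]
     becomes [theta <= 1 / 2]. *)
  set theta := Num.sqrt (2 * alpha * lambda).
  have th0 : 0 <= theta by exact: sqrtr_ge0.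
  have al0 : 0 <= alpha * lambda by rewrite mulr_ge0// ltW.
  have th2 : theta ^+ 2 = 2 * alpha * lambda by rewrite sqr_sqrtr//; lra.
  have thhalf : theta <= 1 / 2.
    by rewrite -(ler_pXn2r (n := 2))// ?nnegrE ?th2; lra.
  have th1 : theta <= 1 by lra.
  have dth : 0 <= dmax d * theta by exact: mulr_ge0.
  have gap := rate_distortion_slope P_dist d_zero Delta_ge0 dth der.
  have alth : alpha * lambda <= theta ^+ 2 by rewrite th2; lra.
  have B0 : 0 <= `|R'| * (dmax d * theta) by rewrite mulr_ge0.
  have := cutoff_rate_ge P_dist d_ge0 d_zero Delta_ge0 l0 th0 th1 alth B0 gap.
  rewrite -/nY => ge; rewrite leeBlDr ?cfin//.
  rewrite EFinB leeBlDr// addeC in ge; apply: le_trans ge _.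
  rewrite leeD2r// lee_fin.
  have -> : c1 * Num.sqrt lambda = 3 / 2 * theta.
    by rewrite /c1 /theta [in RHS]sqrtrM ?mulrA// mulr_ge0.
  (* Here [alpha = 0], as when an alphabet is a singleton: [ln (2 * alpha)] is a default value, but
     both sides vanish. *)
  have [thE|thn0] := eqVneq theta 0; first by rewrite thE eta0 !mulr0 !mul0r !addr0.
  have thp : 0 < theta by rewrite lt_neqAle eq_sym thn0.
  have alpha_gt0 : 0 < alpha.
    rewrite lt_neqAle alpha0 andbT eq_sym; apply: contra_neq thn0 => a0.
    by rewrite /theta a0 mulr0 mul0r sqrtr0.
  have lnE : ln lambda^-1 - ln (2 * alpha) = - 2 * ln theta.
    have : ln (theta ^+ 2) = ln (2 * alpha * lambda) by rewrite th2.
    rewrite expr2 [ln (theta * _)]lnM ?posrE//.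
    rewrite [ln (_ * lambda)]lnM ?posrE ?mulr_gt0// lnV ?posrE//; lra.
  have -> : ln lambda^-1 + c2 = - 2 * ln theta + 4 / 3 * (ln nX + ln nY)
      + 2 / 3 * dmax d * `|R'|.
    by rewrite -lnE /c2 lnM ?posrE//; ring.
  (* After cancellation it remains that [theta <= 2 * eta theta + 2 * theta * ln nX], which follows
     from [ln theta <= theta - 1 <= - 1 / 2]. *)
  have := ler_wpM2l th0 (ln_le_sub1 thp).
  have := ler_wpM2l th0 thhalf.
  have := mulr_ge0 th0 lnX0.
  rewrite /eta; lra.
- apply/fine_cvgP; split.
    by near=> l; apply: cfin; near: l; exact: nbhs_right_gt.
  apply/cvgrPdist_le => e e0.
  have e2 : 0 < e / 2 by rewrite divr_gt0.
  have [r r0 rP] :=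
    rate_distortion_right_continuous P_dist d_ge0 d_zero Delta_ge0 e2.
  (* Here [theta = c ^+ 2] is fixed before [l] tends to 0. The entropy terms are at most
     [c * (3 + 2 * ln nY) <= e / 2], and [dmax d * theta <= r] leaves the other [e / 2] to right
     continuity. *)
  set c := Num.min 1 (Num.min (e / 2 / (3 + 2 * ln nY)) (r / (dmax d + 1))).
  have c0 : 0 < c by rewrite !lt_min ltr01/= !divr_gt0//; lra.
  have c1 : c <= 1 by rewrite ge_min lexx.
  have ce : c * (3 + 2 * ln nY) <= e / 2.
    by rewrite -ler_pdivlMr; [rewrite !ge_min lexx !orbT | lra].
  have cr : c * (dmax d + 1) <= r.
    by rewrite -ler_pdivlMr; [rewrite !ge_min lexx !orbT | lra].
  set theta := c ^+ 2.
  have th0 : 0 <= theta := sqr_ge0 c.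
  have thc : theta <= c by rewrite /theta expr2 -[leRHS]mulr1 ler_wpM2l// ltW.
  have th1 : theta <= 1 by exact: le_trans c1.
  have th20 : 0 < theta ^+ 2 by rewrite !exprn_gt0.
  near=> l.
  have l0 : 0 < l by near: l; exact: nbhs_right_gt.
  have la : l <= theta ^+ 2 / (alpha + 1).
    by near: l; apply: nbhs_right_le; rewrite divr_gt0//; lra.
  have alth : alpha * l <= theta ^+ 2.
    by move: la; rewrite ler_pdivlMr; lra.
  have gap : rate_distortion P d Delta
      <= rate_distortion P d (Delta + dmax d * theta) + e / 2.
    apply: rP; first exact: mulr_ge0.
    by have := ler_wpM2l dm0 thc; lra.
  have := cutoff_rate_ge P_dist d_ge0 d_zero Delta_ge0 l0 th0 th1 alth (ltW e2) gap.
  have := cutoff_rate_le P_dist d_zero l Delta_ge0.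
  rewrite -(fineK (cfin l l0)) !lee_fin /= => ub lb.
  have := eta_le_sqrt th0; rewrite sqrtr_sqr (gtr0_norm c0).
  have := ler_wpM2r lnY0 thc; rewrite -/nY in lb.
  rewrite ger0_norm ?subr_ge0//; lra.
Unshelve. all: by end_near.
Qed.
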